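(* Let $t_n$ be the number of rays of the submodular cone $\mathbb{SC}_n$. For all sufficiently large $n$, $$2^{2^{n-2}}\;\le\; t_n\;\le\; n^{2^n}.$$
   Context: A set function $f:2^{[n]}\to\mathbb{R}$ is submodular if $f(A)+f(B)\ge f(A\cup B)+f(A\cap B)$ for all $A,B\subseteq[n]$. The submodular cone $\mathbb{SC}_n$ is the cone of submodular functions $f:2^{[n]}\to\mathbb{R}$; its rays are counted after quotienting by modular functions (i.e. rays of the pointed cone obtained by quotienting by the lineality space). Equivalently, a deformed $n$-permutahedron is a polytope in $\mathbb{R}^n$ all of whose edges are parallel to vectors $e_i-e_j$; $\mathbb{SC}_n$ is identified with the cone of deformed $n$-permutahedra (under Minkowski sum and dilation), whose lineality space is given by translations, and rays correspond to deformed $n$-permutahedra that are not points and are Minkowski indecomposable ($P=Q+R$ implies that $Q$ and $R$ are translated dilates of $P$), up to translation and positive dilation. *)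

(* Defs.v *)
From mathcomp Require Import all_boot all_order all_algebra.
From mathcomp Require Import finmap.
From mathcomp Require Import all_classical all_reals.

Set Implicit Arguments.
Unset Strict Implicit.
Unset Printing Implicit Defensive.

Import Order.TTheory GRing.Theory Num.Theory.

Local Open Scope classical_set_scope.
Local Open Scope ring_scope.

Definition is_convex_cone (R : realType) (V : lmodType R) (C : set V) : Prop :=
  [/\ C 0,
      (forall x y, C x -> C y -> C (x + y)) &
      (forall (a : R) x, 0 <= a -> C x -> C (a *: x))].

Definition lineality (R : realType) (V : lmodType R) (C : set V) : set V :=
  [set x | C x /\ C (- x)].

Definition is_face (R : realType) (V : lmodType R) (C F : set V) : Prop :=
  [/\ is_convex_cone F,
      F `<=` C &
      (forall x y, C x -> C y -> F (x + y) -> F x /\ F y)].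

(* The rays (one-dimensional faces) of the pointed cone C / lineality C, each
   represented by its preimage under the quotient map, which is a face of C:
   faces of C / lineality C and faces of C correspond bijectively this way.
   Distinct rays of the quotient are thus distinct elements of [rays C], and
   generators that differ by a positive factor and an element of the lineality
   space give the same element. *)
Definition rays (R : realType) (V : lmodType R) (C : set V) : set (set V) :=
  [set F | is_face C F /\
    exists x, ~ lineality C x /\
      F = [set y | exists c l,
             [/\ 0 <= c, lineality C l & y = c *: x + l]]].

(* [R^o] rather than [R] makes the set functions an [lmodType R]. *)
Notation setfun R n := {ffun {set 'I_n} -> R^o}.

Definition submodular (R : realType) (n : nat) (f : setfun R n) : Prop :=
  forall A B : {set 'I_n}, f (A :|: B)%SET + f (A :&: B)%SET <= f A + f B.

Definition modular (R : realType) (n : nat) (f : setfun R n) : Prop :=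
  forall A B : {set 'I_n}, f (A :|: B)%SET + f (A :&: B)%SET = f A + f B.

Definition submodular_cone (R : realType) (n : nat) : set (setfun R n) :=
  [set f | submodular f].
Arguments submodular_cone : clear implicits.

Lemma submodular_coneP (R : realType) (n : nat) :
  is_convex_cone (submodular_cone R n).
Proof.
split=> [A B|f g hf hg A B|a f a0 hf A B]; rewrite !ffunE.
- by [].
- by rewrite addrACA [leRHS]addrACA lerD.
- by rewrite -!scalerDr; apply: ler_wpM2l.
Qed.

Lemma lineality_submodular_cone (R : realType) (n : nat) :
  lineality (submodular_cone R n) = [set f | modular f].
Proof.
apply/seteqP; split=> f /=.
  move=> [hf hNf] A B; apply/eqP; rewrite eq_le hf /=.
  by have := hNf A B; rewrite !ffunE -!opprD lerN2.
move=> hf; split=> A B; first by rewrite hf.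
by rewrite !ffunE -!opprD hf.
Qed.

(* [fset_set] sends an infinite set to the empty set, so that a positive lower
   bound on this number entails that there are finitely many rays. *)
Definition num_rays (R : realType) (n : nat) : nat :=
  #|` fset_set (rays (submodular_cone R n))|%fset.

(* Main.v *)
Require Import Defs.
From mathcomp Require Import finmap all_classical all_reals.
From mathcomp Require Import all_boot all_order all_algebra.
From mathcomp Require Import ring lra zify.

Set Implicit Arguments.
Unset Strict Implicit.
Unset Printing Implicit Defensive.

Import Order.TTheory GRing.Theory Num.Theory.

Local Open Scope set_scope.
Local Open Scope ring_scope.

(** Write [curv f S i j] for the defect f(S+i) + f(S+j) - f(S+i+j) - f(S) of the
    submodular inequality on a two-dimensional face (a square) of the Boolean
    cube.  The function f is submodular iff all defects are nonnegative and
    modular iff they all vanish, so a ray of the cone is a submodular f, taken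
    up to proportionality of its defects, whose vanishing defects force every
    function x with those vanishing defects to have defects proportional to those
    of f ([extremal], [ray_of_rays], [rays_extremal]).

    Lower bound.  The number of rays roughly squares when n grows by one.  Let f
    and g be extremal on n elements, and put f on the sets without a new element
    and t * g - c on the sets with it, where t > 0 is a scalar and c is a modular
    function.  The least c that makes the result submodular makes, for each old
    element i, some defect along i and the new element vanish; this ties the
    modular parts of the two halves together.  What remains is to tie their
    scales, and for this one element z must have two vanishing defects at which
    the marginals of f along z differ.  As t moves from 0 to infinity the
    maximisers of t * (marginal of g) - (marginal of f) move from the minimisers
    of the marginal of f to the maximisers of that of g; if no set is both, there
    is a critical t with the required tie ([separated_tie], [extremal_glue]).  The
    condition [separated] guarantees this for every pair in a family and passes
    to the glued functions ([exists_lift]), hence a family of size k on n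
    elements gives one of size k^2 on n + 1 elements ([ray_family_square]).  The
    induction starts at n = 5 with 256 = 2^(2^3) rays: a graph on five vertices
    gives the function min(2|S|, 4) minus the indicator of the edges, which is
    extremal as soon as odd closed walks pass through each vertex of the
    complement and through each edge in the line graph ([extremal_graph]), and
    there are enough such graphs among the 1024 ([many_rigid]).

    Upper bound.  Cut the cone, modulo its lineality space, by a hyperplane, so
    that rays become vertices of a polytope in dimension less than d = 2^n.
    Choosing a generic linear functional c and, at each vertex, a minimal set Z
    of tight constraints that determines it, one writes c on the hyperplane as a
    constant plus a combination of the constraints in Z with nonzero
    coefficients.  The vertex is therefore the unique minimum of c on the face
    where the constraints of Z with negative coefficients are tight, and the
    unique maximum on the face for the positive ones ([exists_pinned]).  One of
    the two sets has at most d/2 elements, so there are at most twice as many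
    rays as sets of at most 2^(n-1) constraints.  As the facets of the cone come
    from the C(n,2) 2^(n-2) squares, this number is at most n^(2^n)
    ([rays_bound]).  This is the argument of Seidel for the asymptotic upper
    bound theorem, without any general position assumption on the polytope. *)

(** * Curvature of set functions *)

Section Curvature.
Variables (R : realFieldType) (n : nat).
Implicit Types (f g x : {set 'I_n} -> R) (S T A B X : {set 'I_n}) (i j k : 'I_n).

Definition square S i j := [&& i != j, i \notin S & j \notin S].

Definition curv f S i j : R :=
  f (i |: S) + f (j |: S) - f (i |: (j |: S)) - f S.

Definition marg f i S : R := f (i |: S) - f S.

Lemma squareC S i j : square S i j = square S j i.
Proof. by rewrite /square eq_sym; congr (_ && _); rewrite andbC. Qed.

Lemma curvC f S i j : curv f S i j = curv f S j i.
Proof. by rewrite /curv setUCA (addrC (f (i |: S))). Qed.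

Lemma curv_marg f S i j : curv f S i j = marg f i S - marg f i (j |: S).
Proof. by rewrite /curv /marg; ring. Qed.

Lemma marg_anti f i S T :
  (forall S i j, square S i j -> 0 <= curv f S i j) ->
  S \subset T -> i \notin T -> marg f i T <= marg f i S.
Proof.
move=> f_curv; elim: {T}_.+1 {-2}T (ltnSn #|T|) => // m IHm T ltTm sST iT.
have [->//|neST] := eqVneq S T.
have /properP[_ [j jT jS]] : S \proper T by rewrite properEneq neST.
have TE : T = j |: (T :\ j) by rewrite setD1K.
have sSTj : S \subset T :\ j by rewrite subsetD1 sST.
have iTj : i \notin T :\ j by rewrite in_setD1 negb_and iT orbT.
apply: le_trans (IHm (T :\ j) _ sSTj iTj); last first.
  by move: ltTm; rewrite (cardsD1 j T) jT; lia.
rewrite {1}TE -subr_ge0 -curv_marg f_curv // /square iTj setD11 andbT.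
by apply: contraNneq iT => ->.
Qed.

(** Squares suffice: marginals are antitone by [marg_anti], so adding the elements
    of A minus B one by one gains at least as much over A inter B as over B. *)
Lemma submodular_curvP f :
  (forall A B, f (A :|: B) + f (A :&: B) <= f A + f B) <->
  (forall S i j, square S i j -> 0 <= curv f S i j).
Proof.
split=> [f_sub S i j /and3P[neij iS jS]|f_curv A B].
  have := f_sub (i |: S) (j |: S).
  rewrite -setUUl -setUIl -setUA (disjoint_setI0 (_ : [disjoint [set i] & [set j]])).
    by rewrite set0U /curv; lra.
  by rewrite disjoints1 inE.
suff grow X S T : S \subset T -> [disjoint X & T] ->
    f (X :|: T) - f T <= f (X :|: S) - f S.
  have := grow (A :\: B) (A :&: B) B (subsetIr _ _).
  have -> : A :\: B :|: B = A :|: B.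
    by apply/setP=> k; rewrite !inE; case: (k \in B); rewrite ?orbT ?orbF.
  have -> : A :\: B :|: A :&: B = A by rewrite setUC setID.
  have dAB : [disjoint A :\: B & B].
    by rewrite -setI_eq0 setIC setDE setICA setICr setI0.
  by move=> /(_ dAB); lra.
elim: {X}_.+1 {-2}X (ltnSn #|X|) => // m IHm X ltXm sST dXT.
have [->|[j jX]] := set_0Vmem X; first by rewrite !set0U !subrr.
rewrite -(setD1K jX) -!setUA.
have dXjT : [disjoint X :\ j & T] by apply: disjointWl dXT; apply: subD1set.
have := IHm (X :\ j) _ sST dXjT.
have : marg f j (X :\ j :|: T) <= marg f j (X :\ j :|: S).
  apply: marg_anti => //; first exact: setUS.
  by rewrite !inE eqxx /= (disjointFr dXT jX).
have ltXj : (#|X :\ j| < m)%N by move: ltXm; rewrite (cardsD1 j X) jX.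
by rewrite /marg => ? /(_ ltXj); lra.
Qed.

End Curvature.

(** * Rays and extremal functions *)

Section Extremal.
Variables (R : realFieldType) (n : nat).
Implicit Types (f g x : {set 'I_n} -> R).

(** Extremality speaks of the vanishing defects only, so that it needs neither a
    choice of the modular part of f nor one of the scale. *)
Definition extremal f :=
  [/\ forall S i j, square S i j -> 0 <= curv f S i j,
      exists S i j, square S i j /\ curv f S i j != 0
    & forall x,
        (forall S i j, square S i j -> curv f S i j = 0 -> curv x S i j = 0) ->
        exists a, forall S i j, square S i j -> curv x S i j = a * curv f S i j].

Definition proportional f g :=
  exists a, forall S i j, square S i j -> curv f S i j = a * curv g S i j.

Lemma proportional_pos f g : extremal f -> extremal g -> proportional f g ->
  exists2 a, 0 < a & forall S i j, square S i j -> curv f S i j = a * curv g S i j.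
Proof.
move=> [f0 [S [i [j [Sij fN0]]]] _] [g0 _ _] [a fg]; exists a => //.
have := f0 _ _ _ Sij; rewrite le0r (negPf fN0) /= fg //.
by have := g0 _ _ _ Sij; nra.
Qed.

End Extremal.

Section Rays.
Variables (R : realType) (n : nat).
Implicit Types (f g x y : setfun R n).

Local Notation C := (submodular_cone R n).

Lemma curvD x y S i j : curv (x + y) S i j = curv x S i j + curv y S i j.
Proof. by rewrite /curv !ffunE; ring. Qed.

Lemma curvZ a x S i j : curv (a *: x) S i j = a * curv x S i j.
Proof. by rewrite /curv !ffunE /GRing.scale /=; ring. Qed.

Lemma submodular_coneE f :
  C f <-> forall S i j, square S i j -> 0 <= curv f S i j.
Proof. exact: submodular_curvP. Qed.

Lemma linealityE f :
  lineality C f <-> forall S i j, square S i j -> curv f S i j = 0.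
Proof.
rewrite /lineality /= !submodular_coneE; split=> [[f0 Nf0] S i j Sij|f0].
  have := Nf0 _ _ _ Sij; have := f0 _ _ _ Sij.
  by rewrite -scaleN1r curvZ; lra.
by split=> S i j Sij; rewrite -?scaleN1r ?curvZ f0 // mulr0.
Qed.

Definition ray_of f : set (setfun R n) :=
  [set y | exists c l, [/\ 0 <= c, lineality C l & y = c *: f + l]]%classic.

Lemma ray_ofE f y : ray_of f y <->
  exists2 c, 0 <= c & forall S i j, square S i j -> curv y S i j = c * curv f S i j.
Proof.
split=> [[c [l [c0 /linealityE l0 ->]]]|[c c0 yE]].
  by exists c => // S i j Sij; rewrite curvD curvZ l0 ?addr0.
exists c, (y - c *: f); split=> //; last by rewrite addrC subrK.
by apply/linealityE=> S i j Sij; rewrite -scaleNr curvD curvZ yE // mulNr subrr.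
Qed.

(** Summands x and y of a multiple of f have defects between 0 and those of that
    multiple, so they vanish wherever those of f do. *)
Lemma ray_of_rays f : extremal f -> rays C (ray_of f).
Proof.
move=> [f0 [S [i [j [Sij fN0]]]] f_ext].
have fgt0 : 0 < curv f S i j by rewrite lt0r fN0 f0.
split; last first.
  exists f; split=> // /linealityE/(_ _ _ _ Sij) f_eq0.
  by rewrite f_eq0 eqxx in fN0.
split.
- split.
  + by apply/ray_ofE; exists 0 => // T k l _; rewrite mul0r /curv !ffunE; ring.
  + move=> x y /ray_ofE[a a0 xE] /ray_ofE[b b0 yE]; apply/ray_ofE.
    exists (a + b); first exact: addr_ge0.
    by move=> T k l Tkl; rewrite curvD xE // yE // mulrDl.
  + move=> a x a0 /ray_ofE[b b0 xE]; apply/ray_ofE.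
    exists (a * b); first exact: mulr_ge0.
    by move=> T k l Tkl; rewrite curvZ xE // mulrA.
- move=> x /ray_ofE[a a0 xE]; apply/submodular_coneE=> T k l Tkl.
  by rewrite xE // mulr_ge0 // f0.
move=> x y /submodular_coneE x0 /submodular_coneE y0 /ray_ofE[a a0 xyE].
have xy_ray (z : setfun R n) : (forall T k l, square T k l -> 0 <= curv z T k l) ->
    (forall T k l, square T k l -> curv z T k l <= a * curv f T k l) -> ray_of f z.
  move=> z0 zle; case: (f_ext z) => [T k l Tkl fT0|b zE].
    by apply/eqP; rewrite eq_le z0 // -(mulr0 a) -fT0 zle.
  apply/ray_ofE; exists b => //.
  by have := z0 _ _ _ Sij; rewrite zE // pmulr_lge0.
split; apply: xy_ray => // T k l Tkl; rewrite -xyE // curvD.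
  by rewrite lerDl y0.
by rewrite lerDr x0.
Qed.

(** If the defects of x vanish with those of f then M f + x and M f - x are in the
    cone for M large; they add up to a multiple of f, so they lie on its ray. *)
Lemma rays_extremal F : rays C F -> exists2 f : setfun R n, extremal f & F = ray_of f.
Proof.
move=> [[_ sFC F_face] [f [fN FE]]]; have {}FE : F = ray_of f by [].
exists f => //; have fF : F f.
  by rewrite FE; apply/ray_ofE; exists 1 => // S i j _; rewrite mul1r.
have f0 := (submodular_coneE f).1 (sFC _ fF).
split=> //.
  apply: contrapT => H; apply: fN; apply/linealityE => S i j Sij.
  by apply: contrapT => /eqP fN0; apply: H; exists S, i, j.
move=> x x0.
(* At squares where f has defect 0 the quotient is 0, and so is the defect of x. *)
pose M := \sum_(q : {set 'I_n} * 'I_n * 'I_n | square q.1.1 q.1.2 q.2)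
  `|curv x q.1.1 q.1.2 q.2| / curv f q.1.1 q.1.2 q.2.
have xM S i j : square S i j -> `|curv x S i j| <= M * curv f S i j.
  move=> Sij; have [fS0|fSN0] := eqVneq (curv f S i j) 0.
    by rewrite x0 // normr0 fS0 mulr0.
  rewrite -ler_pdivrMr ?lt0r ?fSN0 ?f0 // /M (bigD1 (S, i, j)) //= lerDl.
  by apply: sumr_ge0 => -[[T k] l] /andP[Tkl _]; rewrite divr_ge0 // f0.
pose y : setfun R n := [ffun S => x S].
have yE S i j : curv y S i j = curv x S i j by rewrite /curv !ffunE.
have [| | |Fy _] := F_face (M *: f + y) (M *: f + - y).
- apply/submodular_coneE=> S i j Sij; rewrite curvD curvZ yE.
  by have := xM _ _ _ Sij; rewrite ler_norml; lra.
- apply/submodular_coneE=> S i j Sij; rewrite curvD curvZ -scaleN1r curvZ yE.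
  by have := xM _ _ _ Sij; rewrite ler_norml; lra.
- rewrite addrACA subrr addr0 -scalerDl FE; apply/ray_ofE; exists (M + M).
    by rewrite addr_ge0 //; apply: sumr_ge0 => -[[T k] l] /= Tkl; rewrite divr_ge0 // f0.
  by move=> S i j _; rewrite curvZ.
move: Fy; rewrite FE => /ray_ofE[c _ cE]; exists (c - M) => S i j Sij.
by have := cE _ _ _ Sij; rewrite curvD curvZ yE mulrBl => <-; ring.
Qed.

Lemma ray_of_proportional f g a : 0 < a ->
  (forall S i j, square S i j -> curv f S i j = a * curv g S i j) ->
  ray_of f = ray_of g.
Proof.
move=> a0 fg; apply/seteqP; split=> x /ray_ofE[c c0 xE]; apply/ray_ofE.
  exists (c * a); first by rewrite mulr_ge0 // ltW.
  by move=> S i j Sij; rewrite xE // fg // mulrA.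
exists (c / a); first by rewrite divr_ge0 // ltW.
by move=> S i j Sij; rewrite xE // fg // mulrA divfK // gt_eqF.
Qed.

Lemma ray_of_eq f g : ray_of f = ray_of g -> proportional f g.
Proof.
move=> fg; have : ray_of f f by apply/ray_ofE; exists 1 => // S i j _; rewrite mul1r.
by rewrite fg => /ray_ofE[a _ aE]; exists a.
Qed.

End Rays.

(** * Rank functions of graphs *)

Section TopModular.
Variables (R : realFieldType) (n : nat).
Implicit Types (x : {set 'I_n} -> R) (S T : {set 'I_n}) (i j k : 'I_n).

(** Going down from the full set, each value on a set of size at least m is
    determined by larger sets as soon as two elements are missing; hence x agrees
    there with the modular function that it defines on the full set and on the
    complements of singletons. *)
Lemma top_modular x m :
    (forall (S : {set 'I_n}) i j, square S i j -> (m <= #|S|)%N -> curv x S i j = 0) ->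
  exists2 l : {set 'I_n} -> R, forall S i j, square S i j -> curv l S i j = 0
           & forall S : {set 'I_n}, (m <= #|S|)%N -> x S = l S.
Proof.
move=> x0; pose d i := x setT - x (~: [set i]).
pose l S : R := x setT - \sum_(i in ~: S) d i.
have lM i S : i \notin S -> marg l i S = d i.
  move=> iS; rewrite /marg /l (bigD1 (P := [in ~: S]) i) ?inE //=.
  under [in X in d i + X]eq_bigl => j do rewrite inE -negb_or orbC -in_setU1 -in_setC.
  by ring.
have l0 S i j : square S i j -> curv l S i j = 0.
  move=> /and3P[neij iS jS]; rewrite curv_marg !lM ?subrr //.
  by rewrite !inE negb_or neij.
exists l => // S; elim: {S}_.+1 {-2}S (ltnSn #|~: S|) => // k IHk S ltk mS.
have [/card_le1_eqP le1|/card_gt1P[i [j [iS jS neij]]]] := leqP #|~: S| 1.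
  have [S0|[i iS]] := set_0Vmem (~: S).
    by rewrite /l S0 big_set0 subr0 -[S]setCK S0 setC0.
  suff SE : ~: S = [set i] by rewrite /l SE big_set1 -[S]setCK SE /d; ring.
  apply/eqP; rewrite eqEsubset sub1set iS andbT.
  by apply/subsetP=> j jS; rewrite inE; apply/eqP/le1.
have Sij : square S i j by move: iS jS; rewrite /square neij !inE => -> ->.
move: iS jS; rewrite !inE => iS jS.
have jiS : i \notin j |: S by rewrite !inE negb_or neij.
have up i' T : i' \notin T -> (#|~: T| < k.+1)%N -> (m <= #|T|)%N ->
    [/\ (#|~: (i' |: T)| < k)%N & (m <= #|i' |: T|)%N].
  move=> iT; have := cardsD1 i' (~: T); rewrite inE iT /= setDE setIC -setCU.
  move=> -> ltT mT; split; first exact: ltT.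
  by rewrite cardsU1 iT (leq_trans mT) // leq_addl.
have [ki mi] := up i S iS ltk mS; have [kj mj] := up j S jS ltk mS.
have [kij mij] := up i (j |: S) jiS (ltnW kj) mj.
have := x0 _ _ _ Sij mS; have := l0 _ _ _ Sij.
by rewrite /curv (IHk _ ki mi) (IHk _ kj mj) (IHk _ kij mij); lra.
Qed.

End TopModular.

Section GraphPolymatroid.
Variables (R : realFieldType) (n : nat) (E : pred {set 'I_n}).
Implicit Types (S T : {set 'I_n}) (i j k : 'I_n).

Definition graph_rank S : R :=
  (minn #|S|.*2 4)%:R - ((#|S| == 2) && E S)%:R.

Lemma card_square S i j : square S i j ->
  [/\ #|i |: S| = #|S|.+1, #|j |: S| = #|S|.+1 & #|i |: (j |: S)| = #|S|.+2].
Proof.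
by move=> /and3P[neij iS jS]; rewrite !cardsU1 !inE negb_or neij iS jS.
Qed.

Lemma graph_rankE S : graph_rank S =
  match #|S| with 0 => 0 | 1 => 2 | 2 => 4 - (E S)%:R | _ => 4 end.
Proof.
have min0 : minn 0.*2 4 = 0%N by [].
have min1 : minn 1.*2 4 = 2 by [].
have min2 : minn 2.*2 4 = 4 by [].
have min3 t : minn t.+3.*2 4 = 4 by apply/minn_idPr; rewrite !doubleS.
rewrite /graph_rank.
by case: #|S| => [|[|[|s]]]; rewrite ?min0 ?min1 ?min2 ?min3 /= ?subr0.
Qed.

Lemma curv_graph S i j : square S i j ->
  curv graph_rank S i j =
  match #|S| with
  | 0 => (E (i |: (j |: S)))%:R
  | 1 => 2 - (E (i |: S))%:R - (E (j |: S))%:R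
  | 2 => (E S)%:R
  | _ => 0
  end.
Proof.
move=> /card_square[ci cj cij]; rewrite /curv !graph_rankE ci cj cij.
by case: #|S| => [|[|[|s]]]; ring.
Qed.

(** Together with [edges_unbalanced]: in the complement of the graph, and in its line
    graph, no connected component is bipartite, stated as the rigidity of the
    systems of equations y_a + y_b = c over the edges a b. *)
Definition nonedges_unbalanced := forall (y : 'I_n -> R) c,
  (forall i j, i != j -> ~~ E [set i; j] -> y i + y j = c) ->
  forall i, y i + y i = c.

Definition edges_unbalanced := forall (u : {set 'I_n} -> R) c,
  (forall i j k, i != j -> i != k -> j != k -> E [set i; j] -> E [set i; k] ->
     u [set i; j] + u [set i; k] = c) ->
  forall i j, i != j -> E [set i; j] -> u [set i; j] + u [set i; j] = c.

(** After subtracting a modular function, a function y whose defects vanish with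
    those of the rank function is 0 on sets of size at least 3.  Squares above a
    nonedge give y(ij) = 0 and then y(i) + y(j) = y(0), hence y(i) = y(0)/2 for all
    i; squares above i that involve two edges give y(ij) + y(ik) = y(i), hence
    y(ij) = y(0)/4 on edges.  So y is a multiple of the rank function minus 4. *)
Lemma extremal_graph : (4 <= n)%N -> nonedges_unbalanced -> edges_unbalanced ->
  extremal graph_rank.
Proof.
move=> n_ge4 Ene Eee; have i0 : 'I_n by exists 0%N; lia.
have out2 S : (#|S| <= 2)%N -> exists i j, square S i j.
  move=> leS2; have /card_gt1P[i [j [iS jS neij]]] : (1 < #|~: S|)%N.
    by rewrite cardsCs setCK card_ord; lia.
  by exists i, j; rewrite /square neij; move: iS jS; rewrite !inE => -> ->.
split.
- move=> S i j Sij; rewrite curv_graph //.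
  case: #|S| => [|[|[|s]]] //=.
  by case: (E _) (E _) => [] [] /=; lra.
- have [|j [k Sjk]] := out2 [set i0]; first by rewrite cards1.
  have [Eij|NEij] := boolP (E [set i0; j]).
    exists set0, j, i0; move: (Sjk) => /and3P[_ ji ki]; split.
      by move: ji; rewrite /square !inE andbT => ->.
    rewrite curv_graph; last by move: ji; rewrite /square !inE andbT => ->.
    by rewrite cards0 setU0 setUC Eij oner_eq0.
  exists [set i0], j, k; split=> //; rewrite curv_graph // cards1 setUC (negPf NEij).
  by case: (E _) => /=; apply: lt0r_neq0; lra.
move=> x x0.
have [S i j Sij S3|l l0 xl] := top_modular (x := x) (m := 3).
  by apply: x0 => //; rewrite curv_graph //; case: #|S| S3 => [|[|[|]]].
pose y S := x S - l S.
have curvy S i j : square S i j -> curv x S i j = curv y S i j.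
  by move=> /l0; rewrite /y /curv; lra.
have y3 S : (3 <= #|S|)%N -> y S = 0 by move=> /xl; rewrite /y => ->; rewrite subrr.
have y0 S i j : square S i j -> curv graph_rank S i j = 0 -> curv y S i j = 0.
  by move=> Sij f0; rewrite -curvy // x0.
have y_nonedge i j : i != j -> ~~ E [set i; j] -> y [set i; j] = 0.
  move=> neij NE; have card2 : #|[set i; j]| = 2 by rewrite cards2 neij.
  have [|k [l' Skl]] := out2 [set i; j]; first by rewrite card2.
  have := y0 _ _ _ Skl; rewrite curv_graph // card2 (negPf NE) => /(_ erefl).
  have [ck cl ckl] := card_square Skl; rewrite /curv.
  by rewrite (y3 (k |: _)) ?(y3 (l' |: _)) ?(y3 (k |: (l' |: _))) ?ck ?cl ?ckl ?card2 //; lra.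
have y1 i : y [set i] + y [set i] = y set0.
  move: i; apply: Ene => i j neij NE.
  have S0 : square set0 i j by rewrite /square neij !inE.
  have := y0 _ _ _ S0; rewrite curv_graph // cards0 !setU0 (negPf NE) => /(_ erefl).
  by rewrite /curv !setU0 y_nonedge //; lra.
have y_edge i j : i != j -> E [set i; j] ->
    y [set i; j] + y [set i; j] = y set0 / 2.
  move: i j; apply: Eee => i j k neij neik nejk Eij Eik.
  have Si : square [set i] j k by rewrite /square nejk !inE eq_sym neij eq_sym neik.
  have [cj ck cjk] := card_square Si.
  have f0 : curv graph_rank [set i] j k = 0.
    by rewrite curv_graph // cards1 !(setUC _ [set i]) Eij Eik /=; lra.
  have := y0 _ _ _ Si f0; rewrite /curv.
  rewrite (y3 (_ |: (_ |: _))) ?cjk ?cards1 // !(setUC _ [set i]).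
  by have := y1 i; lra.
suff [a yE] : exists a, forall T, y T = a * (graph_rank T - 4).
  by exists a => S i j Sij; rewrite curvy // /curv !yE; ring.
exists (- (y set0 / 4)) => T.
rewrite graph_rankE; case cT : #|T| => [|[|[|s]]].
- by move/eqP: cT; rewrite cards_eq0 => /eqP->; field.
- by move/eqP/cards1P: cT => [k ->]; have := y1 k; lra.
- move/eqP/cards2P: cT => [k [k' [nek ->]]].
  have [Ek|NEk] := boolP (E _).
    by have := y_edge _ _ nek Ek; rewrite /=; lra.
  by rewrite y_nonedge //=; ring.
- by rewrite y3 ?cT // subrr mulr0.
Qed.

End GraphPolymatroid.

(** * Gluing two extremal functions *)

Section Separated.
Variables (R : realFieldType) (n : nat).
Implicit Types (f g x : {set 'I_n} -> R) (S T : {set 'I_n}) (i j k z : 'I_n).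

(** For f and g both separated by A, no set is at once a minimiser of the marginal
    of f and a maximiser of the marginal of g along z: the former lie in A and the
    latter outside.  The values at the empty set and at the complement of z are
    the extreme ones when the function is submodular. *)
Definition separated z (A : pred {set 'I_n}) f := forall S, z \notin S ->
  if A S then marg f z S < marg f z set0 else marg f z (~: [set z]) < marg f z S.

Lemma extremal_scale f g a : 0 < a ->
  (forall S i j, square S i j -> curv g S i j = a * curv f S i j) ->
  extremal f -> extremal g.
Proof.
move=> a0 gf [f0 [S [i [j [Sij fN0]]]] f_ext]; split.
- by move=> T k l Tkl; rewrite gf // mulr_ge0 ?f0 // ltW.
- by exists S, i, j; rewrite gf // mulf_neq0 // gt_eqF.
move=> x x0; have [T k l Tkl fT0|b xE] := f_ext x.
  by apply: x0 => //; rewrite gf // fT0 mulr0.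
by exists (b / a) => T k l Tkl; rewrite xE // gf // mulrA divfK // gt_eqF.
Qed.

(** Adding j to S changes the marginal along i by the defect of a square, so a
    proportionality of defects integrates to marginals up to a constant. *)
Lemma marg_curv_diff f x a :
  (forall S i j, square S i j -> curv x S i j = a * curv f S i j) ->
  forall i S, i \notin S ->
    marg x i S - a * marg f i S = marg x i set0 - a * marg f i set0.
Proof.
move=> xf i S; elim: {S}_.+1 {-2}S (ltnSn #|S|) => // m IHm S ltSm iS.
have [->//|[j jS]] := set_0Vmem S.
have iSj : i \notin S :\ j by rewrite in_setD1 negb_and iS orbT.
rewrite -(IHm (S :\ j)) //; last by move: ltSm; rewrite (cardsD1 j S) jS.
have neij : i != j by apply: contraNneq iS => ->.
have Sij : square (S :\ j) i j by rewrite /square neij iSj !inE eqxx.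
by have := xf _ _ _ Sij; rewrite !curv_marg setD1K // mulrBr; lra.
Qed.

End Separated.

Section Glue.
Variables (R : realFieldType) (n : nat).
Implicit Types (f g : {set 'I_n} -> R) (x : {set 'I_n.+1} -> R).
Implicit Types (S : {set 'I_n}) (T : {set 'I_n.+1}) (i j k z : 'I_n).

Local Notation w := (lift ord_max).
Local Notation new := (@ord_max n).

(** The cube on n + 1 elements consists of two copies of the cube on n elements: the
    sets [up S], without the new element [ord_max], and the sets [new |: up S]. *)
Definition up S : {set 'I_n.+1} := [set w i | i in S].
Definition dn T : {set 'I_n} := [set i | w i \in T].

Lemma in_up i S : (w i \in up S) = (i \in S).
Proof. by rewrite mem_imset //; apply: lift_inj. Qed.

Lemma new_up S : new \notin up S.
Proof. by apply/imsetP=> -[i _ /eqP]; rewrite (negPf (neq_lift _ _)). Qed.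

Lemma upU1 i S : up (i |: S) = w i |: up S.
Proof. by rewrite /up imsetU1. Qed.

Lemma upK S : dn (up S) = S.
Proof. by apply/setP=> i; rewrite inE in_up. Qed.

Lemma up_newK S : dn (new |: up S) = S.
Proof. by apply/setP=> i; rewrite !inE in_up (eq_sym _ new) (negPf (neq_lift _ _)). Qed.

Lemma up_dn T : T = up (dn T) \/ T = new |: up (dn T).
Proof.
have TE i : (w i \in T) = (i \in dn T) by rewrite inE.
case: (boolP (new \in T)) => newT; [right|left]; apply/setP=> k.
  case: (unliftP new k) => [i|] ->; last by rewrite newT !inE eqxx.
  by rewrite in_setU1 in_up TE (eq_sym _ new) (negPf (neq_lift _ _)).
case: (unliftP new k) => [i|] ->; last by rewrite (negPf newT) (negPf (new_up _)).
by rewrite in_up TE.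
Qed.

Lemma setC1_new z : ~: [set w z] = new |: up (~: [set z]).
Proof.
apply/setP=> k; case: (unliftP new k) => [i|] ->.
  by rewrite in_setU1 in_up !inE (inj_eq lift_inj) (eq_sym _ new) (negPf (neq_lift _ _)).
by rewrite !inE eqxx neq_lift.
Qed.

Definition glue f g T := if new \in T then g (dn T) else f (dn T).

Lemma glue_up f g S : glue f g (up S) = f S.
Proof. by rewrite /glue (negPf (new_up S)) upK. Qed.

Lemma glue_new f g S : glue f g (new |: up S) = g S.
Proof. by rewrite /glue setU11 up_newK. Qed.

Lemma marg_up x i S : marg x (w i) (up S) = marg (x \o up) i S.
Proof. by rewrite /marg /= upU1. Qed.

Lemma marg_new x i S :
  marg x (w i) (new |: up S) = marg (fun S => x (new |: up S)) i S.
Proof. by rewrite /marg setUCA upU1. Qed.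

Lemma curv_up x i j S : curv x (up S) (w i) (w j) = curv (x \o up) S i j.
Proof. by rewrite /curv /= !upU1. Qed.

Lemma curv_new x i j S :
  curv x (new |: up S) (w i) (w j) = curv (fun S => x (new |: up S)) S i j.
Proof. by rewrite !curv_marg !marg_new setUCA -upU1 marg_new. Qed.

Lemma curv_cross x i S : curv x (up S) (w i) new =
  marg (x \o up) i S - marg (fun S => x (new |: up S)) i S.
Proof. by rewrite curv_marg marg_up marg_new. Qed.

Lemma square_up S i j : square (up S) (w i) (w j) = square S i j.
Proof. by rewrite /square !in_up (inj_eq lift_inj). Qed.

Lemma square_ind (P : {set 'I_n.+1} -> 'I_n.+1 -> 'I_n.+1 -> Prop) :
    (forall T (k l : 'I_n.+1), P T k l -> P T l k) ->
    (forall S i j, square S i j -> P (up S) (w i) (w j)) ->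
    (forall S i j, square S i j -> P (new |: up S) (w i) (w j)) ->
    (forall S i, i \notin S -> P (up S) (w i) new) ->
  forall T (k l : 'I_n.+1), square T k l -> P T k l.
Proof.
move=> Psym Pup Pnew Pcross T k l.
case: (unliftP new k) => [i|] ->; case: (unliftP new l) => [j|] ->.
- have [->|->] := up_dn T; first by rewrite square_up; apply: Pup.
  rewrite /square !in_setU1 !in_up (inj_eq lift_inj).
  rewrite !(eq_sym _ new) !(negPf (neq_lift _ _)); exact: Pnew.
- have [->|->] := up_dn T; last by rewrite /square setU11 /= ?andbF.
  by rewrite /square in_up => /and3P[_ iT _]; apply: Pcross.
- have [->|->] := up_dn T; last by rewrite /square setU11 /= ?andbF.
  by rewrite /square in_up => /and3P[_ _ jT]; apply/Psym/Pcross.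
- by rewrite /square eqxx.
Qed.

(** A function x whose defects vanish with those of the glued function has defects
    a * curv f and b * curv g on the two halves.  Two ties along z with distinct
    marginals give a = b, and one tie along each i fixes the constant left open by
    [marg_curv_diff], so that the crossing squares are proportional as well. *)
Lemma extremal_glue f g :
    extremal f -> extremal g ->
    (forall i S, i \notin S -> marg g i S <= marg f i S) ->
    (forall i, exists2 S : {set 'I_n}, i \notin S & marg g i S = marg f i S) ->
    (exists z (S S' : {set 'I_n}), [/\ z \notin S, z \notin S', marg g z S = marg f z S,
       marg g z S' = marg f z S' & marg f z S != marg f z S']) ->
  extremal (glue f g).
Proof.
move=> [f0 [S0 [i0 [j0 [Sij0 fN0]]]] f_ext] [g0 _ g_ext] le_gf tight linked.
have bot : glue f g \o up =1 f by move=> S; apply: glue_up.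
have top S : glue f g (new |: up S) = g S by apply: glue_new.
have margb i S : marg (glue f g \o up) i S = marg f i S by rewrite /marg !bot.
have margt i S : marg (fun S => glue f g (new |: up S)) i S = marg g i S.
  by rewrite /marg !top.
have curvb S i j : curv (glue f g) (up S) (w i) (w j) = curv f S i j.
  by rewrite curv_up !curv_marg !margb.
have curvt S i j : curv (glue f g) (new |: up S) (w i) (w j) = curv g S i j.
  by rewrite curv_new !curv_marg !margt.
have curvx S i : curv (glue f g) (up S) (w i) new = marg f i S - marg g i S.
  by rewrite curv_cross margb margt.
split.
- apply: square_ind => [T i j|S i j Sij|S i j Sij|S i iS].
  + by rewrite curvC.
  + by rewrite curvb f0.
  + by rewrite curvt g0.
  + by rewrite curvx subr_ge0 le_gf.
- by exists (up S0), (w i0), (w j0); rewrite square_up curvb.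
move=> x x0.
have [S i j Sij fS0|a xb] := f_ext (x \o up).
  by rewrite -curv_up x0 ?square_up ?curvb.
have [S i j Sij gS0|b xt] := g_ext (fun S => x (new |: up S)).
  rewrite -curv_new x0 ?curvt //; move: Sij.
  rewrite /square !in_setU1 !in_up (inj_eq lift_inj).
  by rewrite !(eq_sym _ new) !(negPf (neq_lift _ _)).
have x_tight i S : i \notin S -> marg g i S = marg f i S ->
    marg (x \o up) i S = marg (fun S => x (new |: up S)) i S.
  move=> iS gf; apply/eqP; rewrite -subr_eq0 -curv_cross; apply/eqP/x0.
    by rewrite /square in_up iS new_up eq_sym neq_lift.
  by rewrite curvx gf subrr.
have xbE := marg_curv_diff xb; have xtE := marg_curv_diff xt.
(* The two ties along z carry distinct marginals, which forces equal scales. *)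
have ab : a = b.
  have [z [S [S' [zS zS' gS gS' neS]]]] := linked.
  have := x_tight z S zS gS; have := x_tight z S' zS' gS'.
  have := xbE z S zS; have := xbE z S' zS'.
  have := xtE z S zS; have := xtE z S' zS'; rewrite gS gS' => e1 e2 e3 e4 e5 e6.
  have : (a - b) * (marg f z S - marg f z S') = 0.
    transitivity (a * marg f z S - a * marg f z S' -
      (b * marg f z S - b * marg f z S')); [by ring | by lra].
  by move/eqP; rewrite mulf_eq0 !subr_eq0 (negPf neS) orbF => /eqP.
exists a; apply: square_ind => [T i j|S i j Sij|S i j Sij|S i iS].
- by rewrite !(curvC _ _ i).
- by rewrite curvb curv_up xb.
- by rewrite curvt curv_new xt // ab.
have [S' iS' gS'] := tight i; have := x_tight i S' iS' gS'.
have := xbE i S iS; have := xbE i S' iS'; have := xtE i S iS; have := xtE i S' iS'.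
by rewrite curvx curv_cross -ab gS' mulrBr; lra.
Qed.

End Glue.

(** * Squaring a family of rays *)

Section Lift.
Variables (R : realFieldType) (n : nat).
Implicit Types (f g : {set 'I_n} -> R) (S T M : {set 'I_n}) (i j k z : 'I_n).

Local Notation w := (lift ord_max).
Local Notation new := (@ord_max n).

(** Let S maximise the marginal of g and, among the maximisers, minimise that of f.
    For large t it maximises the difference below.  The least t for which it still
    does is positive, as the complement of z has a smaller marginal of f, and at
    that t a set with a smaller marginal of g is another maximiser. *)
Lemma separated_tie z A f g : separated z A f -> separated z A g ->
  exists2 t : R, 0 < t & exists S S' : {set 'I_n},
    [/\ z \notin S, z \notin S', marg f z S != marg f z S',
        t * marg g z S - marg f z S = t * marg g z S' - marg f z S'
      & forall T : {set 'I_n}, z \notin T ->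
          t * marg g z T - marg f z T <= t * marg g z S - marg f z S].
Proof.
move=> sep_f sep_g.
pose a S := marg f z S; pose b S := marg g z S.
have z0 : z \notin set0 by rewrite inE.
case: (@arg_maxP _ _ _ _ (fun S => z \notin S) b z0) => M zM bM.
have {}bM T : z \notin T -> b T <= b M := bM T.
have PM : (z \notin M) && (b M == b M) by rewrite zM eqxx.
case: (@arg_minP _ _ _ _ (fun S => (z \notin S) && (b S == b M)) a PM)
  => S /andP[zS /eqP bS] aS.
have {}aS T : (z \notin T) && (b T == b M) -> a S <= a T := aS T.
pose top := ~: [set z]; have ztop : z \notin top by rewrite !inE eqxx.
have a_top : a top < a S.
  have := sep_f _ zS; case: ifP => // AS _; have := sep_g _ zS; rewrite AS.
  by rewrite ltNge -/(b S) bS bM.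
have b_top : b top < b S.
  rewrite lt_neqAle bS bM // andbT; apply: contraTneq a_top => bE.
  by rewrite -leNgt aS // ztop bE eqxx.
pose r T := (a S - a T) / (b S - b T).
have Ptop : (z \notin top) && (b top < b S) by rewrite ztop.
case: (@arg_maxP _ _ _ _ (fun T => (z \notin T) && (b T < b S)) r Ptop)
  => S' /andP[zS' bS'] rS'.
have {}rS' T : (z \notin T) && (b T < b S) -> r T <= r S' := rS' T.
have t0 : 0 < r S'.
  by apply: lt_le_trans (rS' _ Ptop); rewrite divr_gt0 // subr_gt0.
have tE : r S' * (b S - b S') = a S - a S' by rewrite divfK // subr_eq0 gt_eqF.
exists (r S') => //; exists S, S'; split=> //; rewrite -/(a _) -/(b _).
- by rewrite -subr_eq0 -tE mulf_neq0 ?gt_eqF // subr_gt0.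
- by move: tE; rewrite mulrBr -!/(a _) -!/(b _); lra.
move=> T zT; rewrite -!/(a _) -!/(b _); have [bT|] := ltP (b T) (b S).
  have /rS' : (z \notin T) && (b T < b S) by rewrite zT.
  by rewrite {1}/r ler_pdivrMr ?subr_gt0 // mulrBr; lra.
rewrite bS => bT; have bTE : b T = b M by apply/le_anti; rewrite bT bM.
by rewrite bTE lerD2l lerN2 aS // zT bTE eqxx.
Qed.

(** The glued function takes the least shifts c that keep it submodular, so each old
    element has a tie with the new one; for the element z the scalar t of
    [separated_tie] provides two ties with distinct marginals. *)
Lemma exists_lift z A f g :
    extremal f -> extremal g -> separated z A f -> separated z A g ->
  exists F : {set 'I_n.+1} -> R,
    [/\ extremal F, separated (w z) (A \o @dn n) F, F \o @up n =1 f
      & exists2 t, 0 < t & forall S i j, square S i j ->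
          curv (fun S => F (new |: up S)) S i j = t * curv g S i j].
Proof.
move=> f_ext g_ext sep_f sep_g.
have [t t0 [S [S' [zS zS' neS tie maxS]]]] := separated_tie sep_f sep_g.
have /fin_all_exists[m mP] i : exists M : {set 'I_n}, i \notin M /\ forall T, i \notin T ->
    t * marg g i T - marg f i T <= t * marg g i M - marg f i M.
  have i0 : i \notin set0 by rewrite inE.
  case: (@arg_maxP _ _ _ _ (fun S => i \notin S)
    (fun T => t * marg g i T - marg f i T) i0) => M iM maxM.
  by exists M.
pose c i := t * marg g i (m i) - marg f i (m i).
pose G T := t * g T - \sum_(i in T) c i.
have margG i T : i \notin T -> marg G i T = t * marg g i T - c i.
  by move=> iT; rewrite /marg /G big_setU1 //=; ring.
have curvG T i j : square T i j -> curv G T i j = t * curv g T i j.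
  move=> /and3P[neij iT jT]; rewrite !curv_marg !margG //; first by ring.
  by rewrite !inE negb_or neij.
have leG i T : i \notin T -> marg G i T <= marg f i T.
  by move=> iT; rewrite margG // /c; have := (mP i).2 T iT; lra.
have eqG i : marg G i (m i) = marg f i (m i).
  by rewrite margG ?(mP i).1 // /c; ring.
have cz : c z = t * marg g z S - marg f z S.
  by apply/le_anti; rewrite /c maxS ?(mP z).1 // (mP z).2.
exists (glue f G); split.
- apply: extremal_glue => //; first exact: extremal_scale curvG g_ext.
    by move=> i; exists (m i); rewrite ?eqG ?(mP i).1.
  by exists z, S, S'; split=> //; rewrite margG // cz; move: tie; lra.
- have bot : glue f G \o @up n =1 f by move=> T; apply: glue_up.
  have margb i T : marg (glue f G) (w i) (up T) = marg f i T.
    by rewrite marg_up /marg !bot.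
  have margt i T : marg (glue f G) (w i) (new |: up T) = marg G i T.
    by rewrite marg_new /marg !glue_new.
  have up0 : up set0 = set0 :> {set 'I_n.+1} by rewrite /up imset0.
  have ztop : z \notin ~: [set z] by rewrite !inE eqxx.
  move=> T; rewrite setC1_new -up0 /=.
  have [->|->] := up_dn T; set U := dn T.
    rewrite in_up upK !margb margt => zU; have := sep_f _ zU.
    by case: ifP => // _; apply: le_lt_trans; apply: leG.
  rewrite in_setU1 in_up up_newK !margt margb eq_sym (negPf (neq_lift _ _)) /=.
  move=> zU; case: ifP => AU.
    by have := sep_f _ zU; rewrite AU; apply: le_lt_trans; apply: leG.
  by have := sep_g _ zU; rewrite AU !margG // => lt_g; rewrite ltrD2r ltr_pM2l.
- by move=> T; rewrite /= glue_up.
exists t => // T i j Tij; rewrite -curvG //.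
by rewrite /curv !glue_new.
Qed.

End Lift.

Section Families.
Variable R : realFieldType.

(** The separating pair z, A is common to the whole family, so that any two of its
    members can be glued. *)
Definition ray_family n (I : finType) := exists (z : 'I_n) (A : pred {set 'I_n})
    (F : I -> {set 'I_n} -> R),
  [/\ forall a, extremal (F a), forall a, separated z A (F a)
    & forall a b, proportional (F a) (F b) -> a = b].

(** The two halves of a lift recover the two functions up to proportionality, so
    distinct pairs give distinct rays. *)
Lemma ray_family_square n (I : finType) :
  ray_family n I -> ray_family n.+1 (I * I)%type.
Proof.
move=> [z [A [F [F_ext F_sep F_inj]]]].
have H (a : I * I) := exists_lift (F_ext a.1) (F_ext a.2) (F_sep a.1) (F_sep a.2).
have [G GP] := fin_all_exists H.
exists (lift ord_max z), (A \o @dn n), G; split=> [a|a|[a1 a2] [b1 b2] [c Gc]].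
- by have [] := GP a.
- by have [] := GP a.
have [_ _ /= Ga [s s0 Gs]] := GP (a1, a2); have [_ _ /= Gb [t t0 Gt]] := GP (b1, b2).
congr (_, _); apply: F_inj; [exists c | exists (c * t / s)] => S i j Sij.
  have := Gc (up S) (lift ord_max i) (lift ord_max j).
  by rewrite square_up => /(_ Sij); rewrite !curv_up /curv !Ga !Gb.
have Snew : square (ord_max |: up S) (lift ord_max i) (lift ord_max j).
  move: Sij; rewrite /square !in_setU1 !in_up (inj_eq lift_inj).
  by rewrite !(eq_sym _ ord_max) !(negPf (neq_lift _ _)).
have := Gc _ _ _ Snew; rewrite !curv_new Gs // Gt // => e.
by apply: (mulfI (lt0r_neq0 s0)); rewrite e; field; apply: lt0r_neq0.
Qed.

End Families.

(** * Graphs on five vertices *)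

Section Base.
Variable R : realFieldType.

(** Along z the marginals are at least 1 on sets of size at most 1, at most 1 on sets
    of size 2 and 0 above, while the extreme values are 2 and 0. *)
Lemma separated_graph n (E : pred {set 'I_n}) (z : 'I_n) : (4 <= n)%N ->
  separated z [pred S : {set 'I_n} | 2 <= #|S|]%N (graph_rank R E).
Proof.
move=> n4 S zS; rewrite /= /marg !graph_rankE.
rewrite !cardsU1 zS !inE eqxx cards0 cardsC1 card_ord /=.
have -> : n.-1 = (n - 4).+3 by lia.
case: #|S| => [|[|[|s]]] /=; try by lra.
  by case: (E _) => /=; lra.
by case: (E _) => /=; lra.
Qed.

Definition walk_step (X : eqType) (r : rel X) (V s : seq X) :=
  [seq y <- V | has (r^~ y) s].

Definition closed_walk (X : eqType) (r : rel X) (V : seq X) m x :=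
  x \in iter m (walk_step r V) [:: x].

(** Along an edge y is reflected about c/2, and an odd number of reflections that
    fixes y x leaves only the value c/2. *)
Lemma odd_closed_walk (X : eqType) (r : rel X) V (y : X -> R) c m x :
    (forall a b, a \in V -> b \in V -> r a b -> y a + y b = c) ->
  x \in V -> odd m -> closed_walk r V m x -> y x + y x = c.
Proof.
move=> yr xV odd_m; suff H k b : b \in iter k (walk_step r V) [:: x] ->
    b \in V /\ y b = if odd k then c - y x else y x.
  by move=> /H[_]; rewrite odd_m; lra.
elim: k b => [|k IHk] b /=; first by rewrite inE => /eqP->.
rewrite mem_filter => /andP[/hasP[a /IHk[aV ya] rab] bV]; split=> //.
by have := yr _ _ aV bV rab; rewrite ya; case: (odd k) => /=; lra.
Qed.

(** A graph on the vertices 0, ..., 4 is coded by ten bits, one per pair in this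
    list; plain numbers and lists keep the enumeration of all graphs executable. *)
Definition pairs5 : seq (nat * nat) :=
  [:: (0, 1); (0, 2); (0, 3); (0, 4); (1, 2);
      (1, 3); (1, 4); (2, 3); (2, 4); (3, 4)]%N.

Definition edge (b : bitseq) (i j : nat) :=
  nth false b (index (minn i j, maxn i j) pairs5).

Definition edges b := [seq p <- pairs5 | edge b p.1 p.2].

Definition nonadjacent b (i j : nat) := (i != j) && ~~ edge b i j.

Definition incident (p q : nat * nat) :=
  (p != q) && [|| p.1 == q.1, p.1 == q.2, p.2 == q.1 | p.2 == q.2].

(** Closed walks of length 7 and 5 cover all the shorter odd ones, since a walk can
    go back and forth along its last edge. *)
Definition rigid b :=
  all (closed_walk (nonadjacent b) (iota 0 5) 7) (iota 0 5) &&
  all (closed_walk incident (edges b) 5) (edges b).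

Fixpoint bitseqs m : seq bitseq :=
  if m is m'.+1 then [seq c :: s | c <- [:: true; false], s <- bitseqs m']
  else [:: [::]].

(** There are 313 rigid graphs; 2^(2^(n-2)) is 256 at n = 5. *)
Lemma many_rigid : exists L : seq bitseq,
  [/\ uniq L, (256 <= size L)%N & forall b, b \in L -> size b = 10 /\ rigid b].
Proof.
pose L := [seq b <- bitseqs 10 | rigid b].
have /and3P[uL szL /allP L10] :
    [&& uniq L, 256 <= size L & all (fun b => size b == 10) L]%N by vm_compute.
exists L; split; [exact: uL | exact: szL | move=> b bL].
split; first exact/eqP/L10.
by move: bL; rewrite mem_filter => /andP[].
Qed.

Definition graph_of b : pred {set 'I_5} := fun S =>
  [exists i : 'I_5, exists j : 'I_5, [&& S == [set i; j], i != j & edge b i j]].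

Lemma edgeC b i j : edge b i j = edge b j i.
Proof. by rewrite /edge minnC maxnC. Qed.

Lemma graph_ofE b (i j : 'I_5) : i != j -> graph_of b [set i; j] = edge b i j.
Proof.
move=> neij; apply/existsP/idP => [[k /existsP[l /and3P[/eqP ijkl nekl ekl]]]|eij].
  have := set21 i j; have := set22 i j; rewrite ijkl !inE.
  move: neij => /[swap] /orP[] /eqP-> /[swap] /orP[] /eqP->; rewrite ?eqxx // => _.
  by rewrite edgeC.
by exists i; apply/existsP; exists j; rewrite eqxx neij.
Qed.

Lemma edge_bitseq b : size b = 10 -> b = [seq edge b p.1 p.2 | p <- pairs5].
Proof.
move=> b10; apply: (@eq_from_nth _ false); first by rewrite size_map.
rewrite b10 => k k10; rewrite (nth_map (0, 0)%N) //.
by move: k k10; do 10![case=> [|] //].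
Qed.

Lemma mem_pairs5 p : (p \in pairs5) = (p.1 < p.2 < 5)%N.
Proof. by case: p => [[|[|[|[|i]]]] [|[|[|[|[|j]]]]]] /=; rewrite ?ltnS ?andbF. Qed.

Lemma rigid_nonedges b : rigid b -> nonedges_unbalanced R (graph_of b).
Proof.
rewrite /rigid => /andP[Hb _] y c yc i; move/allP: Hb => Hb.
have iV : val i \in iota 0 5 by rewrite mem_iota ltn_ord.
have -> : i = inord (val i) by rewrite inord_val.
pose y' k := y (inord k); apply: (odd_closed_walk (y := y') _ iV _ (Hb _ iV)) => //.
move=> k l; rewrite !mem_iota !add0n /= => k5 l5 /andP[nekl kl].
have ne : inord k != inord l :> 'I_5 by rewrite -val_eqE /= !inordK.
by apply: yc => //; rewrite graph_ofE // !inordK.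
Qed.

Lemma rigid_edges b : rigid b -> edges_unbalanced R (graph_of b).
Proof.
rewrite /rigid => /andP[_ Hb] u c uc; move/allP: Hb => Hb.
pose u' (p : nat * nat) := u [set inord p.1; inord p.2].
have uE p : p \in edges b -> u' p + u' p = c.
  move=> pE; apply: (odd_closed_walk _ pE _ (Hb p pE)) => //.
  move=> {p pE} [i j] [k l]; rewrite !mem_filter !mem_pairs5 /u' /=.
  move=> /and3P[ij ltij j5] /and3P[kl ltkl l5].
  have inordE m p : (m < 5)%N -> (p < 5)%N -> (inord m == inord p :> 'I_5) = (m == p).
    by move=> m5 p5; rewrite -val_eqE /= !inordK.
  have i5 := ltn_trans ltij j5; have k5 := ltn_trans ltkl l5.
  have E' m p : (m < 5)%N -> (p < 5)%N -> m != p -> edge b m p ->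
      graph_of b [set inord m; inord p].
    by move=> m5 p5 nemp mp; rewrite graph_ofE ?inordE // !inordK.
  move=> /andP[neq]; rewrite /= => /or4P[] /eqP e; subst.
  - apply: uc; rewrite ?inordE ?E' //; try lia.
    by apply: contraNneq neq => ->.
  - rewrite (setUC [set inord k]); apply: uc; rewrite ?inordE ?E' //; try lia.
    by rewrite edgeC.
  - rewrite (setUC [set inord i]); apply: uc; rewrite ?inordE ?E' //; try lia.
    by rewrite edgeC.
  - rewrite (setUC [set inord i]) (setUC [set inord k]).
    apply: uc; rewrite ?inordE ?E' //; try lia; try by rewrite edgeC.
    by apply: contraNneq neq => ->.
move=> i j neij; rewrite graph_ofE // => eij.
wlog ltij : i j neij eij / (i < j)%N.
  move=> H; case: (ltngtP i j) => [|ltji|/val_inj ij]; first exact: H.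
    by rewrite setUC; apply: H; rewrite 1?eq_sym 1?edgeC.
  by rewrite ij eqxx in neij.
have := uE (val i, val j); rewrite /u' /= !inord_val; apply.
by rewrite mem_filter /= eij mem_pairs5 ?ltij ?ltn_ord.
Qed.

Lemma ray_family_base : exists2 I : finType, #|I| = 256 & ray_family R 5 I.
Proof.
have [L [uL szL LP]] := many_rigid.
exists ('I_256 : finType); first by rewrite card_ord.
pose bits (a : 'I_256) := nth [::] L a.
have ltL (a : 'I_256) : (a < size L)%N by apply: leq_trans szL.
have bitsP a : size (bits a) = 10 /\ rigid (bits a) by apply/LP/mem_nth/ltL.
have F_ext a : extremal (graph_rank R (graph_of (bits a))).
  have [_ rig] := bitsP a.
  by apply: extremal_graph => //; [apply: rigid_nonedges | apply: rigid_edges].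
exists ord0, [pred S : {set 'I_5} | 2 <= #|S|]%N,
  (fun a => graph_rank R (graph_of (bits a))).
split=> [//|a|a b]; first exact: separated_graph.
move=> /(proportional_pos (F_ext a) (F_ext b))[c c0 cE].
suff : bits a = bits b.
  by move/eqP; rewrite nth_uniq // => /eqP/val_inj.
rewrite (edge_bitseq (bitsP a).1) (edge_bitseq (bitsP b).1).
apply/eq_in_map => -[i j]; rewrite mem_pairs5 /= => /andP[ltij j5].
have i5 := ltn_trans ltij j5.
have neij : Ordinal i5 != Ordinal j5 by rewrite -val_eqE /= neq_ltn ltij.
have Sij : square set0 (Ordinal i5) (Ordinal j5) by rewrite /square neij !inE.
have := cE _ _ _ Sij; rewrite !curv_graph // cards0 setU0 !graph_ofE //=.
by case: (edge _ i j); case: (edge _ i j) => //=; lra.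
Qed.

End Base.

(** * Vertices determined by few constraints *)

Section Pinning.
Variables (R : realFieldType) (m d : nat) (A : 'M[R]_(m, d)).
Implicit Types (Y Z K : {set 'I_m}) (x r : 'cV[R]_d) (c : 'rV[R]_d).

Lemma separating_vector p q (M : 'M[R]_(p, d)) (B : 'M[R]_(q, d)) :
  ~~ (M <= B)%MS -> exists2 x : 'cV_d, B *m x = 0 & M *m x != 0.
Proof.
rewrite submxE => /eqP MB.
have [j jP] : exists j, col j (M *m cokermx B) != 0.
  apply/existsP; apply: contra_notT MB; rewrite negb_exists => /forallP H.
  apply/matrixP=> i j; have := H j; rewrite negbK => /eqP/colP/(_ i).
  by rewrite !mxE.
exists (cokermx B *m delta_mx j 0).
  by rewrite mulmxA mulmx_coker mul0mx.
by rewrite mulmxA -colE.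
Qed.

(** A space M included in none of finitely many subspaces has a vector outside their
    union.  Given c that avoids all but W, and a row r of M outside W, each
    subspace contains c + t r for at most one t. *)
Lemma exists_generic p (M : 'M[R]_(p, d)) (Ws : seq 'M[R]_d) :
    {in Ws, forall W, ~~ (M <= W)%MS} ->
  exists2 c : 'rV_d, (c <= M)%MS & {in Ws, forall W, ~~ (c <= W)%MS}.
Proof.
elim: Ws => [|W Ws IHWs] notM; first by exists 0; rewrite ?sub0mx.
have [|c cM cWs] := IHWs; first by move=> V VWs; apply: notM; rewrite inE VWs orbT.
have /row_subPn[i notWi] : ~~ (M <= W)%MS by apply: notM; rewrite mem_head.
pose e t := c + t%:R *: row i M.
have finite_bad (V : 'M[R]_d) : ~~ (c <= V)%MS \/ ~~ (row i M <= V)%MS ->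
    exists N, forall t, (N <= t)%N -> ~~ (e t <= V)%MS.
  move=> notV; have [[t et]|H] := pselect (exists t, (e t <= V)%MS); last first.
    by exists 0%N => t _; apply/negP => et; apply: H; exists t.
  exists t.+1 => t' ltt; apply/negP => et'.
  have rV : (row i M <= V)%MS.
    have : (e t' - e t <= V)%MS by rewrite addmx_sub // eqmx_opp.
    rewrite /e opprD addrACA subrr add0r -scalerBl -natrB; last exact: ltnW.
    by rewrite eqmx_scale // pnatr_eq0 subn_eq0 -ltnNge.
  case: notV => /negP; apply=> //.
  rewrite (_ : c = e t - t%:R *: row i M); last by rewrite addrK.
  by rewrite addmx_sub // eqmx_opp scalemx_sub.
have [N NP] : exists N, {in W :: Ws, forall V, forall t, (N <= t)%N -> ~~ (e t <= V)%MS}.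
  have {cWs notM IHWs} : {in W :: Ws, forall V, ~~ (c <= V)%MS \/ ~~ (row i M <= V)%MS}.
    move=> V; rewrite inE => /predU1P[->|/cWs]; [by right|by left].
  elim: (W :: Ws) => [|V Vs IHVs] notV; first by exists 0%N.
  have [|N NP] := IHVs; first by move=> U UVs; apply: notV; rewrite inE UVs orbT.
  have [|N' N'P] := finite_bad V; first by apply: notV; rewrite mem_head.
  exists (maxn N N') => U; rewrite inE => /predU1P[->|UVs] t; rewrite geq_max => /andP[Nt N't].
    exact: N'P.
  exact: NP.
exists (e N); first by rewrite addmx_sub // scalemx_sub // row_sub.
by move=> V VWs; apply: NP.
Qed.

(** Level 1 of this function is the hyperplane that cuts the cone, modulo its
    lineality space, in a polytope. *)
Definition weight x := \sum_i (A *m x) i 0.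

Definition extremal_vec r :=
  [/\ forall i, 0 <= (A *m r) i 0, weight r = 1
    & forall x, (forall i, (A *m r) i 0 = 0 -> (A *m x) i 0 = 0) ->
      exists a, A *m x = a *: (A *m r)].

(** The vertex r is the unique minimum, modulo the lineality space, of e * c on the
    face of the polytope where the constraints in K are tight. *)
Definition pinned c K (e : R) r :=
  (forall i, i \in K -> (A *m r) i 0 = 0) /\
  forall x, (forall i, 0 <= (A *m x) i 0) -> weight x = weight r ->
    (forall i, i \in K -> (A *m x) i 0 = 0) ->
    e * (c *m r) 0 0 <= e * (c *m x) 0 0
    /\ (e * (c *m r) 0 0 = e * (c *m x) 0 0 -> A *m x = A *m r).

Lemma pinned_inj c K e r r' : extremal_vec r -> extremal_vec r' ->
  pinned c K e r -> pinned c K e r' -> A *m r = A *m r'.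
Proof.
move=> [r0 r1 _] [r'0 r'1 _] [rK rP] [r'K r'P].
have [le1 eq1] := rP r' r'0 (etrans r'1 (esym r1)) r'K.
have [le2 _] := r'P r r0 (etrans r1 (esym r'1)) rK.
by rewrite eq1 //; apply/le_anti; rewrite le1 le2.
Qed.

(** The normalisation [weight] counts as a constraint that always belongs to Z. *)
Definition span_of Z : 'M[R]_d :=
  ((\matrix_i (if i \in Z then row i A else 0)) + (\sum_i row i A)%R)%MS.

Lemma submx_ker p q (B : 'M[R]_(p, d)) (C : 'M[R]_(q, d)) x :
  C *m x = 0 -> (B <= C)%MS -> B *m x = 0.
Proof. by move=> Cx /submxP[D ->]; rewrite -mulmxA Cx mulmx0. Qed.

Lemma entry_row p (B : 'M[R]_(p, d)) x i : (B *m x) i 0 = (row i B *m x) 0 0.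
Proof. by rewrite -row_mul [RHS]mxE. Qed.

Lemma weightE x : weight x = ((\sum_i row i A) *m x) 0 0.
Proof.
rewrite mulmx_suml summxE; apply: eq_bigr => i _.
exact: entry_row.
Qed.

Lemma row_span_of Z i : i \in Z -> (row i A <= span_of Z)%MS.
Proof.
move=> iZ; apply: submx_trans (addsmxSl _ _).
by apply: (eq_row_sub i); rewrite rowK iZ.
Qed.

Lemma span_of_sub Z p (B : 'M[R]_(p, d)) :
  (forall i, i \in Z -> (row i A <= B)%MS) -> ((\sum_i row i A)%R <= B)%MS ->
  (span_of Z <= B)%MS.
Proof.
move=> ZB sB; rewrite addsmx_sub sB andbT; apply/row_subP => i.
by rewrite rowK; case: ifP => [/ZB|_]; rewrite ?sub0mx.
Qed.

Lemma span_of_mono Y Z : Y \subset Z -> (span_of Y <= span_of Z)%MS.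
Proof.
move=> sYZ; apply: span_of_sub => [i iY|]; last exact: addsmxSr.
by rewrite row_span_of // (subsetP sYZ).
Qed.

Lemma span_of_ker Z x :
  (forall i, i \in Z -> (A *m x) i 0 = 0) -> weight x = 0 ->
  (A <= span_of Z)%MS -> A *m x = 0.
Proof.
move=> xZ x0; apply: submx_ker.
apply/eqP; rewrite -sub_kermx; apply: span_of_sub => [i iZ|]; rewrite sub_kermx.
  by apply/eqP/matrixP=> k l; rewrite -row_mul !ord1 !mxE -[RHS](xZ i iZ) mxE.
by apply/eqP/matrixP=> k l; rewrite !ord1 -weightE x0 mxE.
Qed.

Lemma span_of_setD1 Z i : i \in Z -> (span_of Z <= span_of (Z :\ i) + row i A)%MS.
Proof.
move=> iZ; apply: span_of_sub => [j jZ|].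
  have [->|neij] := eqVneq j i; first exact: addsmxSr.
  by apply: submx_trans (addsmxSl _ _); rewrite row_span_of // !inE neij.
by apply: submx_trans (addsmxSl _ _); apply: addsmxSr.
Qed.

(** A minimal spanning set is independent. *)
Lemma card_minimal_span Z :
    (A <= span_of Z)%MS ->
    (forall i, i \in Z -> ~~ (A <= span_of (Z :\ i))%MS) ->
  (#|Z| <= d)%N.
Proof.
move=> AZ minZ; apply: leq_trans (rank_leq_col (span_of Z)).
suff H (Y : {set 'I_m}) : Y \subset Z -> (#|Y| <= \rank (span_of Y))%N by apply: H.
elim: {Y}_.+1 {-2}Y (ltnSn #|Y|) => // k IHk Y ltYk sYZ.
have [->|[i iY]] := set_0Vmem Y; first by rewrite cards0.
have sYi : Y :\ i \subset Z by apply: subset_trans sYZ; apply: subD1set.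
move: ltYk; rewrite (cardsD1 i Y) iY => /IHk/(_ sYi) leY.
apply: leq_ltn_trans leY _; apply: rank_ltmx.
have iZ : i \in Z by apply: (subsetP sYZ).
rewrite ltmxE span_of_mono ?subD1set //=; apply: contra (minZ i iZ) => sYYi.
have ri : (row i A <= span_of (Z :\ i))%MS.
  apply: submx_trans (row_span_of iY) (submx_trans sYYi _).
  by apply: span_of_mono; apply: setSD.
by apply: submx_trans AZ (submx_trans (span_of_setD1 iZ) _); rewrite addsmx_sub ri submx_refl.
Qed.

(** Otherwise some x of weight 0 satisfies the constraints tight at r but not all
    constraints; being a multiple of r of weight 0, it satisfies them all. *)
Lemma extremal_span r : extremal_vec r ->
  (A <= span_of [set i | (A *m r) i 0 == 0])%MS.
Proof.
move=> [_ r1 r_ext]; apply/negPn/negP => /separating_vector[x Wx Ax].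
set T := [set i | _] in Wx.
have xT i : (A *m r) i 0 = 0 -> (A *m x) i 0 = 0.
  move=> ri0; have iT : i \in T by rewrite inE ri0.
  by rewrite entry_row (submx_ker Wx (row_span_of iT)) mxE.
have [a xE] := r_ext x xT; case/negP: Ax.
have x0 : weight x = 0 by rewrite weightE (submx_ker Wx (addsmxSr _ _)) mxE.
have : weight x = a * weight r.
  by rewrite /weight xE mulr_sumr; apply: eq_bigr => i _; rewrite mxE.
by rewrite x0 r1 mulr1 xE => <-; rewrite scale0r.
Qed.

(** With Z minimal among the sets of tight constraints that span, genericity makes
    all coefficients q of c on Z nonzero.  On the face where the constraints in K
    are tight, c exceeds its value at r by the sum of q_i times the i-th constraint
    over Z minus K; when all these q_i have the same sign, the sum has that sign
    and vanishes only where all of Z is tight, that is, at r. *)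
Lemma exists_pinned c r :
    (c <= A)%MS ->
    (forall Z, ~~ (A <= span_of Z)%MS -> ~~ (c <= span_of Z)%MS) ->
    extremal_vec r ->
  exists K (b : bool), (#|K|.*2 <= d)%N /\ pinned c K ((-1) ^+ b) r.
Proof.
move=> cA c_gen r_ext; have AT := extremal_span r_ext.
set T := [set i | _] in AT.
have [Z minZ sZT] := @minset_exists _ (fun Z => (A <= span_of Z)%MS) _ AT.
have /minsetP[AZ Zmin] := minZ.
have ZD1 i : i \in Z -> ~~ (A <= span_of (Z :\ i))%MS.
  move=> iZ; apply/negP => /Zmin/(_ (subD1set _ _)) ZE.
  by have := setD11 i Z; rewrite ZE iZ.
have leZd := card_minimal_span AZ ZD1.
have /sub_addsmxP[[u v] /= cE] := submx_trans cA AZ.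
pose q i := u 0 i.
have cx x : (c *m x) 0 0 = \sum_(i in Z) q i * (A *m x) i 0 + v 0 0 * weight x.
  rewrite cE mulmxDl mxE; congr (_ + _).
    rewrite -mulmxA mxE [RHS]big_mkcond; apply: eq_bigr => i _.
    rewrite entry_row rowK; case: ifP => _; first by rewrite -entry_row.
    by rewrite mul0mx mxE mulr0.
  by rewrite -mulmxA mxE big_ord1 weightE.
have qN0 i : i \in Z -> q i != 0.
  move=> iZ; apply: contra (c_gen _ (ZD1 i iZ)) => /eqP qi0.
  rewrite cE addmx_sub //; last first.
    by apply: submx_trans (submxMl _ _) (addsmxSr _ _).
  rewrite mulmx_sum_row summx_sub // => j _; rewrite rowK.
  case: ifP => jZ; last by rewrite scaler0 sub0mx.
  have [->|neji] := eqVneq j i; first by rewrite -/(q i) qi0 scale0r sub0mx.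
  by rewrite scalemx_sub // row_span_of // !inE neji.
have rZ i : i \in Z -> (A *m r) i 0 = 0.
  by move=> /(subsetP sZT); rewrite inE => /eqP.
have pin K (b : bool) : K \subset Z ->
    (forall i, i \in Z :\: K -> 0 < (-1) ^+ b * q i) -> pinned c K ((-1) ^+ b) r.
  move=> sKZ qpos; split=> [i /(subsetP sKZ)|x x0 xr xK]; first exact: rZ.
  have cxr : (-1) ^+ b * (c *m x) 0 0 = (-1) ^+ b * (c *m r) 0 0
      + \sum_(i in Z :\: K) (-1) ^+ b * q i * (A *m x) i 0.
    rewrite !cx xr [in RHS]big1 => [|i iZ]; last by rewrite rZ ?mulr0.
    rewrite (big_setID K) /= (setIidPr sKZ) big1 => [|i iK]; last by rewrite xK ?mulr0.
    rewrite !add0r mulrDr mulr_sumr [LHS]addrC.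
    by congr (_ + _); apply: eq_bigr => i _; rewrite mulrA.
  have term0 i : i \in Z :\: K -> 0 <= (-1) ^+ b * q i * (A *m x) i 0.
    by move=> iZK; rewrite mulr_ge0 // ltW // qpos.
  rewrite cxr; split; first by rewrite lerDl sumr_ge0.
  rewrite -[LHS]addr0 => /addrI/esym/eqP; rewrite psumr_eq0 // => /allP sum0.
  apply/eqP; rewrite -subr_eq0 -mulmxBr; apply/eqP/(@span_of_ker Z) => //.
    move=> i iZ; rewrite mulmxBr mxE [in X in _ + X]mxE rZ // subr0.
    have [iK|NiK] := boolP (i \in K); first exact: xK.
    have iZK : i \in Z :\: K by rewrite inE NiK.
    have := sum0 i (mem_index_enum _); rewrite iZK /= mulf_eq0 => /orP[|/eqP//].
    by rewrite gt_eqF // qpos.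
  rewrite /weight; under eq_bigr => i _ do rewrite mulmxBr mxE [in X in _ + X]mxE.
  by rewrite sumrB -!/(weight _) xr subrr.
(* Fixing the smaller of the two sign classes leaves the other one free. *)
pose P := [set i in Z | 0 < q i]; pose N := [set i in Z | q i < 0].
have sP : P \subset Z by apply/subsetP => i; rewrite inE => /andP[].
have sN : N \subset Z by apply/subsetP => i; rewrite inE => /andP[].
have ZE : (#|P| + #|N| = #|Z|)%N.
  rewrite -cardsUI (_ : P :&: N = set0) ?cards0 ?addn0; last first.
    by apply/setP=> i; rewrite !inE; case: ltgtP; rewrite ?andbF.
  apply: eq_card => i; rewrite !inE -andb_orr; case: (boolP (i \in Z)) => //= iZ.
  by rewrite orbC -neq_lt qN0.
have [leNP|ltPN] := leqP #|N| #|P|.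
  exists N, false; split; first by rewrite -addnn (leq_trans _ leZd) // -ZE leq_add2r.
  apply: pin => // i; rewrite !inE mul1r => /andP[iN iZ].
  by move: iN; rewrite iZ /= -leNgt le0r (negPf (qN0 _ iZ)).
exists P, true; split; first by rewrite -addnn (leq_trans _ leZd) // -ZE leq_add2l ltnW.
apply: pin => // i; rewrite !inE mulN1r oppr_gt0 => /andP[iP iZ].
by move: iP; rewrite iZ /= -leNgt le_eqVlt (negPf (qN0 _ iZ)).
Qed.

End Pinning.

(** * Binomial estimates *)

Section Counting.
Local Open Scope nat_scope.

Lemma card_small_sets (I : finType) k :
  #|[set K : {set I} | #|K| <= k]| = \sum_(i < k.+1) 'C(#|I|, i).
Proof.
rewrite -sum1_card (partition_big (fun K : {set I} => inord #|K| : 'I_k.+1) predT) //=.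
apply: eq_bigr => i _; rewrite -card_draws -sum1_card; apply: eq_bigl => K.
rewrite !inE; apply/andP/eqP => [[leK /eqP <-]|KE]; first by rewrite inordK.
by rewrite KE inord_val -ltnS ltn_ord eqxx.
Qed.

(** That is (1 + 1/q)^q <= 3, from (1 + 1/q)^k <= 1 + k/q + (k/q)^2 for k <= q. *)
Lemma expn_succ_le3 q : 0 < q -> q.+1 ^ q <= 3 * q ^ q.
Proof.
move=> q0; suff H k : k <= q -> q.+1 ^ k * q ^ 2 <= q ^ k * (q ^ 2 + k * q + k ^ 2).
  have := H q (leqnn q).
  by rewrite (_ : _ + _ = 3 * q ^ 2) ?mulnA ?leq_pmul2r ?expn_gt0 ?q0 1?mulnC //; ring.
elim: k => [|k IHk] ltkq; first by rewrite !expn0; lia.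
have := IHk (ltnW ltkq); rewrite !expnS !expn0 !muln1.
set a := q.+1 ^ k; set b := q ^ k => {}IHk.
have : a * (q * q) * q.+1 <= b * (q * q + k * q + k * k) * q.+1 by rewrite leq_mul2r IHk orbT.
have : b * ((q * q + k * q + k * k) * q.+1) <= b * (q * (q * q + k.+1 * q + k.+1 * k.+1)).
  by rewrite leq_mul2l; apply/orP; right; nia.
by lia.
Qed.

(** Chernoff bound: for i <= k the term C(qk, i) q^(qk - i) of the expansion of
    (q + 1)^(qk) is at least C(qk, i) q^(qk - k). *)
Lemma sum_bin_le q k : 0 < q -> 0 < k -> \sum_(i < k.+1) 'C(q * k, i) <= (3 * q) ^ k.
Proof.
move=> q0 k0; have kqk : k <= q * k by rewrite leq_pmull.
rewrite -(leq_pmul2r (_ : 0 < q ^ (q * k - k))) ?expn_gt0 ?q0 //.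
apply: (@leq_trans (q.+1 ^ (q * k))); last first.
  rewrite expnM expnMn -mulnA -expnD subnKC // [in leqRHS]expnM -expnMn.
  by rewrite leq_exp2r // expn_succ_le3.
rewrite -(addn1 q) expnDn big_distrl /=.
rewrite (big_ord_widen (q * k).+1 (fun i => 'C(q * k, i) * q ^ (q * k - k))) ?ltnS //.
rewrite big_mkcond leq_sum // => i _; case: ifP => // leik.
by rewrite exp1n muln1 leq_mul2l leq_pexp2l ?orbT // leq_sub2l.
Qed.

(** With q = n^2 / 4 there are at most q k constraints, so the sum is at most
    (3 n^2 / 4)^k = (3/4)^k n^(2^n), and the factor 2 is absorbed by (3/4)^k. *)
Lemma rays_bound n m k : 3 <= n -> k = 2 ^ n.-1 -> m = 'C(n, 2) * 2 ^ (n - 2) ->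
  (\sum_(i < k.+1) 'C(m, i)) * 2 <= n ^ (2 ^ n).
Proof.
move=> n3 kE mE; pose q := n ^ 2 %/ 4.
have leq4 : 4 * q <= n ^ 2 by rewrite mulnC leq_trunc_div.
have q0 : 0 < q by rewrite divn_gt0 //; nia.
have k3 : 3 <= k.
  by rewrite kE (@leq_trans (2 ^ 2)) // leq_pexp2l //; lia.
have lem : m <= q * k.
  have ltq : n ^ 2 < 4 * q + 4.
    have := ltn_pmod (n ^ 2) (isT : 0 < 4); have := divn_eq (n ^ 2) 4.
    by rewrite -/q; lia.
  rewrite mE kE (_ : n.-1 = (n - 2).+1); last by lia.
  rewrite expnS mulnA leq_mul2r; apply/orP; right.
  by have := bin2 n; rewrite -divn2; nia.
have leS : \sum_(i < k.+1) 'C(m, i) <= (3 * q) ^ k.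
  by apply: leq_trans (sum_bin_le q0 (ltnW (ltnW k3))); apply: leq_sum => i _; apply: leq_bin2l.
have le34 : 2 * 3 ^ k <= 4 ^ k.
  rewrite -(subnKC k3); elim: (k - 3) => // j; rewrite addnS !expnS.
  by move: (3 ^ _) (4 ^ _) => a b; lia.
apply: leq_trans (leq_mul leS (leqnn 2)) _.
rewrite expnMn mulnC mulnA (leq_trans (leq_mul le34 (leqnn _))) // -expnMn.
rewrite (_ : 2 ^ n = 2 * k); last by rewrite kE -expnS prednK //; lia.
by rewrite expnM leq_exp2r // ; lia.
Qed.

End Counting.

(** * The upper bound *)

Section Constraints.
Variable n : nat.

(** Only squares with i < j: each facet must be counted once, since a factor 2 in
    their number would spoil the final estimate. *)
Definition constraint : finType :=
  {q : {set 'I_n} * 'I_n * 'I_n | square q.1.1 q.1.2 q.2 && (q.1.2 < q.2)%N}.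

Lemma card_constraint : #|constraint| = ('C(n, 2) * 2 ^ (n - 2))%N.
Proof.
rewrite card_sig -sum1_card.
rewrite (eq_bigl (fun q : {set 'I_n} * 'I_n * 'I_n =>
  square q.1.1 q.1.2 q.2 && (q.1.2 < q.2)%N)) //.
pose P (S : {set 'I_n}) (i j : 'I_n) := square S i j && (i < j)%N.
transitivity (\sum_(S : {set 'I_n}) \sum_(i < n) \sum_(j < n | P S i j) 1)%N.
  rewrite pair_big_dep /= pair_big_dep /=.
  by apply: eq_bigl => -[[S i] j].
rewrite exchange_big /=; under eq_bigr do rewrite (exchange_big_dep xpredT) //=.
transitivity (\sum_(i < n) \sum_(j < n | (i < j)%N) 2 ^ (n - 2))%N.
  apply: eq_bigr => i _; rewrite [RHS]big_mkcond; apply: eq_bigr => j _.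
  rewrite /P; case: ifP => ltij; last by rewrite big_pred0 // => S; rewrite andbF.
  have neij : i != j by rewrite neq_ltn ltij.
  transitivity (\sum_(S in powerset (~: [set i; j])) 1)%N.
    apply: eq_bigl => S; rewrite andbT /square neij powersetE /=.
    apply/andP/subsetP => [[iS jS] k kS|sS].
      by rewrite !inE negb_or; apply/andP; split; apply: contraTneq kS => ->.
    by split; apply/negP => /sS; rewrite !inE eqxx ?orbT.
  by rewrite sum1_card card_powerset cardsCs setCK cards2 neij card_ord.
rewrite (exchange_big_dep xpredT) //=; under eq_bigr do rewrite sum_nat_const.
rewrite -big_distrl /= -bin2_sum big_mkord; congr (_ * _)%N.
apply: eq_bigr => j _; rewrite -sum1_card -(big_ord_widen _ (fun=> 1%N)) ?sum1_card ?card_ord //.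
exact: ltnW.
Qed.

End Constraints.

Section UpperBound.
Variables (R : realType) (n : nat).
Implicit Types (S : {set 'I_n}).

Local Notation C := (submodular_cone R n).
Local Notation dim := #|{set 'I_n}|.

Definition curv_at (f : {set 'I_n} -> R) (q : constraint n) :=
  curv f (val q).1.1 (val q).1.2 (val q).2.

Definition curv_mx : 'M[R]_(#|constraint n|, dim) :=
  \matrix_(i, j) curv_at (fun S => (S == enum_val j)%:R) (enum_val i).

Definition vec (f : {set 'I_n} -> R) : 'cV[R]_dim := \col_j f (enum_val j).

Lemma vec_surj (x : 'cV[R]_dim) : exists f : {set 'I_n} -> R, x = vec f.
Proof.
exists (fun S => x (enum_rank S) 0); apply/colP => j.
by rewrite mxE enum_valK.
Qed.

Lemma curv_mxE (f : {set 'I_n} -> R) i :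
  (curv_mx *m vec f) i 0 = curv_at f (enum_val i).
Proof.
have delta X : \sum_(T : {set 'I_n}) (X == T)%:R * f T = f X.
  rewrite (bigD1 X) //= eqxx mul1r big1 ?addr0 // => T.
  by rewrite eq_sym => /negPf->; rewrite mul0r.
rewrite mxE; under eq_bigr do rewrite !mxE.
rewrite -(big_enum_val (A := predT)
  (fun T => curv_at (fun S => (S == T)%:R) (enum_val i) * f T)) /=.
rewrite /curv_at /curv; under eq_bigr do rewrite !mulrBl mulrDl.
by rewrite !sumrB big_split /= !delta.
Qed.

Lemma square_constraint S (i j : 'I_n) : square S i j ->
  exists q, forall f : {set 'I_n} -> R, curv_at f q = curv f S i j.
Proof.
move=> Sij; case: (ltngtP i j) => [ltij|ltji|/val_inj ij].
- have qP : square S i j && (i < j)%N by rewrite Sij.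
  by exists (Sub (S, i, j) qP : constraint n) => f; rewrite /curv_at SubK.
- have qP : square S j i && (j < i)%N by rewrite squareC Sij.
  by exists (Sub (S, j, i) qP : constraint n) => f; rewrite /curv_at SubK curvC.
- by move: Sij; rewrite /square ij eqxx.
Qed.

Lemma constraint_square (q : constraint n) : square (val q).1.1 (val q).1.2 (val q).2.
Proof. by case/andP: (valP q). Qed.

Lemma extremal_vecP (f : {set 'I_n} -> R) :
  extremal f -> weight curv_mx (vec f) = 1 -> extremal_vec curv_mx (vec f).
Proof.
move=> [f0 _ f_ext] f1; split; [|exact: f1|].
  by move=> i; rewrite curv_mxE f0 // constraint_square.
move=> x; have [y ->] := vec_surj x => y0.
have [S i j /square_constraint[q qE] fS0|a yE] := f_ext y.
  have := y0 (enum_rank q); rewrite !curv_mxE enum_rankK !qE; exact.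
exists a; apply/colP => i; rewrite [RHS]mxE !curv_mxE.
exact/yE/constraint_square.
Qed.

Lemma rays_vec F : rays C F ->
  exists f : setfun R n, extremal_vec curv_mx (vec f) /\ F = ray_of f.
Proof.
move=> /rays_extremal[f f_ext ->]; have [f0 [S [i [j [Sij fN0]]]] _] := f_ext.
have w0 : 0 < weight curv_mx (vec f).
  have wE : weight curv_mx (vec f) = \sum_q curv_at f q.
    rewrite /weight; under eq_bigr do rewrite curv_mxE.
    by rewrite -(big_enum_val (A := predT) (curv_at f)).
  have q0 q : 0 <= curv_at f q by apply/f0/constraint_square.
  rewrite wE lt0r sumr_ge0 // andbT; apply/eqP => /psumr_eq0P H.
  by case/negP: fN0; have [q <-] := square_constraint Sij; rewrite H.
exists ((weight curv_mx (vec f))^-1 *: f); split.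
  apply: extremal_vecP.
    have w0' : 0 < (weight curv_mx (vec f))^-1 by rewrite invr_gt0.
    by apply: extremal_scale w0' _ f_ext => T k l _; apply: curvZ.
  rewrite /weight; under eq_bigr do rewrite curv_mxE /curv_at curvZ -/(curv_at f _) -curv_mxE.
  by rewrite -mulr_sumr mulVf // gt_eqF.
apply: (@ray_of_proportional _ _ _ _ (weight curv_mx (vec f))) => // T k l _.
by rewrite curvZ mulrA divff ?mul1r // gt_eqF.
Qed.

(** Each ray is coded by a set of constraints on which it is pinned and by the choice
    between minimum and maximum. *)
Lemma rays_code : exists h : set (setfun R n) -> {set 'I_#|constraint n|} * bool,
  (forall F, rays C F -> (#|(h F).1|.*2 <= 2 ^ n)%N) /\
  (forall F G, rays C F -> rays C G -> h F = h G -> F = G).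
Proof.
have [c cA c_gen] : exists2 c : 'rV_dim, (c <= curv_mx)%MS &
    {in [seq span_of curv_mx Z | Z <- enum {set 'I_#|constraint n|} &
         ~~ (curv_mx <= span_of curv_mx Z)%MS], forall W, ~~ (c <= W)%MS}.
  by apply: exists_generic => W /mapP[Z]; rewrite mem_filter => /andP[NZ _] ->.
have {}c_gen Z : ~~ (curv_mx <= span_of curv_mx Z)%MS -> ~~ (c <= span_of curv_mx Z)%MS.
  by move=> NZ; apply/c_gen/map_f; rewrite mem_filter NZ mem_enum.
have card_dim : dim = (2 ^ n)%N by rewrite -cardsT -powersetT card_powerset cardsT card_ord.
have /boolp.choice[h hP] F : exists Kb : {set 'I_#|constraint n|} * bool, rays C F ->
    exists f : setfun R n, [/\ extremal_vec curv_mx (vec f), F = ray_of f,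
      (#|Kb.1|.*2 <= 2 ^ n)%N & pinned curv_mx c Kb.1 ((-1) ^+ Kb.2) (vec f)].
  have [FC|NF] := pselect (rays C F); last by exists (finset.set0, false).
  have [f [f_ext FE]] := rays_vec FC.
  have [K [b [leK pin]]] := exists_pinned cA c_gen f_ext.
  by exists (K, b) => _; exists f; rewrite -card_dim.
exists h; split=> [F /hP[f []]//|F G /hP[f [f_ext -> _ fpin]] /hP[g [g_ext -> _ gpin]] hFG].
rewrite -hFG in gpin; have fg := pinned_inj f_ext g_ext fpin gpin.
apply: (@ray_of_proportional _ _ _ _ 1) => // S i j Sij; rewrite mul1r.
by have [q qE] := square_constraint Sij; rewrite -!qE -(enum_rankK q) -!curv_mxE fg.
Qed.

Lemma finite_rays : finite_set (rays C).
Proof.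
have [h [_ h_inj]] := rays_code.
have h_in : {in rays C &, injective h}.
  by move=> F G /set_mem FC /set_mem GC; apply: h_inj.
have : finite_set (h @` rays C)%classic by apply: finite_finset.
by apply: card_le_finite; move: (inj_card_eq h_in); rewrite card_eq_le => /andP[].
Qed.

Lemma num_rays_le (T : finType) (B : {set T}) (h : set (setfun R n) -> T) :
  (forall F, rays C F -> h F \in B) ->
  (forall F G, rays C F -> rays C G -> h F = h G -> F = G) -> (num_rays R n <= #|B|)%N.
Proof.
move=> hB h_inj; rewrite /num_rays.
set s : seq _ := enum_fset (fset_set (rays C)).
have sP F : F \in s -> rays C F.
  by move=> Fs; have := in_fset_set finite_rays F; rewrite [LHS]Fs => /esym/set_mem.
have us : uniq [seq h F | F <- s].
  by rewrite map_inj_in_uniq ?fset_uniq // => F G /sP FC /sP GC; apply: h_inj.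
rewrite -(size_map h) -(card_uniqP us); apply/subset_leq_card/subsetP => _ /mapP[F /sP FC ->].
exact: hB.
Qed.

Lemma num_rays_upper : (3 <= n)%N -> (num_rays R n <= n ^ (2 ^ n))%N.
Proof.
move=> n3; have [h [hK h_inj]] := rays_code.
pose B := setX [set K : {set 'I_#|constraint n|} | #|K| <= 2 ^ n.-1]%N [set: bool].
apply: leq_trans (num_rays_le (B := B) (h := h) _ h_inj) _.
  have powE : (2 ^ n = (2 ^ n.-1).*2)%N by rewrite -mul2n -expnS prednK // ltnW // ltnW.
  by move=> F /hK; rewrite !inE andbT powE leq_double.
rewrite cardsX cardsT card_bool card_small_sets card_ord.
exact: rays_bound (card_constraint n).
Qed.

End UpperBound.

(** * The lower bound *)

Section LowerBound.
Variable R : realType.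

Lemma ray_family_num_rays n (I : finType) : ray_family R n I -> (#|I| <= num_rays R n)%N.
Proof.
move=> [z [A [F [F_ext _ F_inj]]]].
pose f a : setfun R n := [ffun S => F a S].
have fE a S i j : curv (f a) S i j = curv (F a) S i j by rewrite /curv !ffunE.
have f_ext a : extremal (f a).
  by apply: extremal_scale ltr01 _ (F_ext a) => S i j _; rewrite fE mul1r.
rewrite /num_rays.
have us : uniq [seq ray_of (f a) | a <- enum I].
  rewrite map_inj_uniq ?enum_uniq // => a b /ray_of_eq[c ab]; apply: F_inj.
  by exists c => S i j Sij; rewrite -!fE ab.
rewrite cardE -(size_map (fun a => ray_of (f a))); apply: uniq_leq_size us _ => _ /mapP[a _ ->].
have -> := in_fset_set (finite_rays R n); exact/mem_set/ray_of_rays.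
Qed.

(** The size 256^(2^m) is 2^(2^(n-2)) for n = m + 5. *)
Lemma ray_family_iter m : exists2 I : finType, #|I| = (256 ^ (2 ^ m))%N & ray_family R (m + 5) I.
Proof.
elim: m => [|m [I cardI famI]]; first exact: ray_family_base.
exists (I * I)%type; last exact: ray_family_square famI.
by rewrite card_prod cardI -expnD addnn -mul2n -expnS.
Qed.

Lemma num_rays_lower n : (5 <= n)%N -> (2 ^ (2 ^ (n - 2)) <= num_rays R n)%N.
Proof.
move=> n5; have [I cardI famI] := ray_family_iter (n - 5).
have powE : (2 ^ (n - 2) = 8 * 2 ^ (n - 5))%N.
  by rewrite -[8%N]/(2 ^ 3)%N -expnD; congr (2 ^ _)%N; lia.
rewrite subnK // in famI; apply: leq_trans (ray_family_num_rays famI).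
by rewrite cardI powE expnM.
Qed.

End LowerBound.

Theorem theorem2 (R : realType) :
  exists N : nat, forall n : nat, (N <= n)%N ->
    finite_set (rays (submodular_cone R n)) /\
    (2 ^ (2 ^ (n - 2)) <= num_rays R n <= n ^ (2 ^ n))%N.
Proof.
exists 5%N => n n5; split; first exact: finite_rays.
by rewrite num_rays_lower // num_rays_upper // ltnW // ltnW.
Qed.
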